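(* Consider the following sequential closeness test (Algorithm 2), observing i.i.d. samples $A_1,A_2,\dots$ from $\mathcal{D}_1$ and $B_1,B_2,\dots$ from $\mathcal{D}_2$ on $[n]$. At each time $t=1,2,\dots$, with empirical distributions $\tilde{\mathcal{D}}_{1,t},\tilde{\mathcal{D}}_{2,t}$ of $A_1,\dots,A_t$ and $B_1,\dots,B_t$ and $\Phi_t=\sqrt{\log\!\big(2^{n-1}t(t+1)/\delta\big)/t}$: if $\mathrm{TV}(\tilde{\mathcal{D}}_{1,t},\tilde{\mathcal{D}}_{2,t})>\Phi_t$, stop and output $2$; else if $\mathrm{TV}(\tilde{\mathcal{D}}_{1,t},\tilde{\mathcal{D}}_{2,t})\le\varepsilon-\Phi_t$, stop and output $1$; otherwise continue. Let $\tau_1=\inf\{t\ge1:\mathrm{TV}(\tilde{\mathcal{D}}_{1,t},\tilde{\mathcal{D}}_{2,t})\le\varepsilon-\Phi_t\}$ and $\tau_2=\inf\{t\ge1:\mathrm{TV}(\tilde{\mathcal{D}}_{1,t},\tilde{\mathcal{D}}_{2,t})>\Phi_t\}$. Then Algorithm 2 is $\delta$-correct, and for $n\le\mathcal{O}(\log(1/\delta)^{1/3})$: $$\mathbb{E}(\tau_1(\mathcal{D},\mathcal{D}))\le\frac{\log(2^{n+1}/\delta)}{\varepsilon^2}+\mathcal{O}\left(\frac{\log(2^{n+1}/\delta)^{2/3}}{\varepsilon^2}\right)\ \text{ if }\mathcal{D}_1=\mathcal{D}_2=\mathcal{D},$$ $$\mathbb{E}(\tau_2(\mathcal{D}_1,\mathcal{D}_2))\le\frac{\log(2^{n+1}/\delta)}{\mathrm{TV}(\mathcal{D}_1,\mathcal{D}_2)^2}+\mathcal{O}\left(\frac{\log(2^{n+1}/\delta)^{2/3}}{\mathrm{TV}(\mathcal{D}_1,\mathcal{D}_2)^2}\right)\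 \text{ if }\mathrm{TV}(\mathcal{D}_1,\mathcal{D}_2)>\varepsilon,$$ where $\mathcal{O}$ hides universal constants.
   Context: $[n]=\{1,\dots,n\}$, $n\ge2$, $\varepsilon\in(0,1)$, $\delta\in(0,1)$, $\mathrm{TV}(\mathcal{D},\mathcal{D}')=\frac12\sum_i|\mathcal{D}_i-\mathcal{D}'_i|$. The problem is to distinguish $H_1:\mathcal{D}_1=\mathcal{D}_2$ from $H_2:\mathrm{TV}(\mathcal{D}_1,\mathcal{D}_2)>\varepsilon$ for unknown $\mathcal{D}_1,\mathcal{D}_2$. $\delta$-correct means: under $H_1$ the algorithm outputs $2$ before $1$ with probability at most $\delta$, and under $H_2$ it outputs $1$ before $2$ with probability at most $\delta$.
   Formalization: The expectation bounds, false for universal constants as ε→0 (or TV→0) with δ fixed, are proved assuming log(1/ε) ≤ C₀ log(1/δ)^{2/3} for τ₁ and log(1/TV(D₁,D₂)) ≤ C₀ log(1/δ)^{2/3} for τ₂, with the O-constant depending only on C₀. *)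

(* Defs.v *)
From mathcomp Require Import all_boot all_order all_algebra.
From mathcomp Require Import all_classical all_reals all_analysis.

Set Implicit Arguments.
Unset Strict Implicit.
Unset Printing Implicit Defensive.

Import Order.TTheory GRing.Theory Num.Theory.

Local Open Scope classical_set_scope.
Local Open Scope ring_scope.

Definition is_distribution (R : realType) (n : nat) (D : 'I_n -> R) : Prop :=
  (forall i, 0 <= D i) /\ \sum_(i < n) D i = 1.

Definition TV (R : realType) (n : nat) (D1 D2 : 'I_n -> R) : R :=
  2^-1 * \sum_(i < n) `|D1 i - D2 i|.

Definition empirical (R : realType) (n t : nat) (x : t.-tuple 'I_n) :
    'I_n -> R :=
  fun i => (count_mem i x)%:R / t%:R.

(* 'I_n carries no measurableType structure (for n = 0 it is not pointed), so
   measurability and independence of 'I_n-valued random variables refer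
   directly to the discrete sigma-algebra: every E : set 'I_n is measurable. *)
Definition discrete_RV (d : measure_display) (T : measurableType d) (n : nat)
    (X : T -> 'I_n) : Prop :=
  forall E : set 'I_n, measurable (X @^-1` E).

Definition mutually_independent (R : realType) (d : measure_display)
    (T : measurableType d) (P : probability T R) (n : nat) (I : choiceType)
    (X : I -> T -> 'I_n) : Prop :=
  forall (s : seq I) (E : I -> set 'I_n), uniq s ->
    P (\bigcap_(k in [set` s]) (X k @^-1` E k)) =
    (\prod_(k <- s) P (X k @^-1` E k))%E.

(* A s and B s are the samples number s + 1; all of them, of both sequences,
   are mutually independent. *)
Definition iid_samples (R : realType) (n : nat) (d : measure_display)
    (T : measurableType d) (P : probability T R)
    (A B : nat -> T -> 'I_n) (D1 D2 : 'I_n -> R) : Prop :=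
  [/\ forall s, discrete_RV (A s) /\ discrete_RV (B s),
      forall s i, P (A s @^-1` [set i]) = (D1 i)%:E,
      forall s i, P (B s @^-1` [set i]) = (D2 i)%:E
    & mutually_independent P
        (fun k : nat + nat => match k with inl s => A s | inr s => B s end)].

Definition first_samples (n : nat) (T : Type) (X : nat -> T -> 'I_n) (t : nat)
    (w : T) : t.-tuple 'I_n :=
  [tuple X s w | s < t].

Inductive decision := Output1 | Output2 | Continue.

(* What to do at time t, given the first t samples of each sequence. *)
Definition sequential_test (n : nat) : Type :=
  forall t : nat, t.-tuple 'I_n -> t.-tuple 'I_n -> decision.

Definition decision_at (n : nat) (T : Type) (alg : sequential_test n)
    (A B : nat -> T -> 'I_n) (t : nat) (w : T) : decision :=
  alg t (first_samples A t w) (first_samples B t w).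

(* The event that alg stops and outputs v; times start at 1. *)
Definition outputs (n : nat) (T : Type) (alg : sequential_test n)
    (A B : nat -> T -> 'I_n) (v : decision) : set T :=
  [set w | exists t : nat, [/\ (0 < t)%N, decision_at alg A B t w = v
     & forall s : nat, (0 < s < t)%N -> decision_at alg A B s w = Continue]].

Definition delta_correct (R : realType) (n : nat) (alg : sequential_test n)
    (eps delta : R) : Prop :=
  forall (d : measure_display) (T : measurableType d) (P : probability T R)
    (A B : nat -> T -> 'I_n) (D1 D2 : 'I_n -> R),
  is_distribution D1 -> is_distribution D2 -> iid_samples P A B D1 D2 ->
  (D1 = D2 -> (P (outputs alg A B Output2) <= delta%:E)%E) /\
  (eps < TV D1 D2 -> (P (outputs alg A B Output1) <= delta%:E)%E).

Definition Phi (R : realType) (n : nat) (delta : R) (t : nat) : R :=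
  Num.sqrt (ln (2 ^+ n.-1 * t%:R * t.+1%:R / delta) / t%:R).

Definition algorithm2 (R : realType) (n : nat) (eps delta : R) :
    sequential_test n :=
  fun t a b =>
    let tv : R := TV (empirical R a) (empirical R b) in
    if Phi n delta t < tv then Output2
    else if tv <= eps - Phi n delta t then Output1
    else Continue.

Definition tv_at (R : realType) (n : nat) (T : Type) (A B : nat -> T -> 'I_n)
    (t : nat) (w : T) : R :=
  TV (empirical R (first_samples A t w)) (empirical R (first_samples B t w)).

(* The infimum of the empty set is +oo. *)
Definition tau1 (R : realType) (n : nat) (eps delta : R) (T : Type)
    (A B : nat -> T -> 'I_n) (w : T) : \bar R :=
  ereal_inf [set t%:R%:E | t in
    [set t : nat | (0 < t)%N /\ tv_at R A B t w <= eps - Phi n delta t]].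

Definition tau2 (R : realType) (n : nat) (delta : R) (T : Type)
    (A B : nat -> T -> 'I_n) (w : T) : \bar R :=
  ereal_inf [set t%:R%:E | t in
    [set t : nat | (0 < t)%N /\ Phi n delta t < tv_at R A B t w]].

(* Main.v *)
Require Import Defs.
From mathcomp Require Import all_boot all_order all_algebra.
From mathcomp Require Import all_classical all_reals all_analysis.
Import Order.TTheory GRing.Theory Num.Theory.
Local Open Scope classical_set_scope.
Local Open Scope ring_scope.
Import numFieldNormedType.Exports.
From mathcomp Require Import measurable_realfun ring lra.
Set Implicit Arguments.
Unset Strict Implicit.
Unset Printing Implicit Defensive.

(** TV(p, q) is the maximum of p(S) - q(S) over sets S of points, and Hoeffding's
    inequality for the 2t samples bounds the deviation of each empirical
    difference beyond x by exp(- t x^2). When D1 = D2 a union bound over the 2^n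
    sets S gives 2^n exp(- t Phi_t^2) = 2 delta / (t (t + 1)) as probability of
    a wrong output at time t; this is twice what one would like, but
    Phi_1 > 1 >= TV, so the sum starts at t = 2 and equals delta. When
    D1 <> D2 one set, attaining TV(D1, D2), suffices.

    For the expectations, put l = L^(1/3) and let e be eps or TV(D1, D2). Once
    t e^2 >= u0 = l^3 + K l^2, all logarithmic terms are absorbed and
    Phi_t <= e l / (l + c), so the probability of continuing at time t is at most
    2^n exp(- t e^2 eta^2) with eta = c / (l + c). The part of the exponent coming
    from u0 cancels 2^n because n = O(l), and the remaining geometric series
    sums to O(l^2 / e^2). *)

(** * Moment generating function of a Bernoulli variable *)

Lemma is_derive_nincr (R : realType) (f f' : R -> R) (t : R) :
  (forall x : R, is_derive x 1 f (f' x)) -> (forall x, 0 <= x -> f' x <= 0) ->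
  0 <= t -> f t <= f 0.
Proof.
move=> fd f'le t0; apply: (@ler0_derive1_nincr R f 0 t) => //.
- by move=> x; rewrite in_itv/= => /andP[/ltW x0 _]; rewrite derive1E derive_val f'le.
- by apply: derivable_within_continuous => x _.
Qed.

(** Hoeffding's lemma: the quotient [G] of the two sides equals 1 at 0 and is nonincreasing from
    there on, since its logarithmic derivative is at most 0 by [sl]. *)
Lemma bernoulli_mgf_le (R : realType) (p t : R) : 0 <= p <= 1 -> 0 <= t ->
  1 - p + p * expR t <= expR (p * t + t ^+ 2 / 8).
Proof.
move=> /andP[p0 p1] t0.
pose W : R -> R := cst (1 - p) + p *: (@expR R).
have WE x : W x = 1 - p + p * expR x by [].
have W0 x : 0 < W x.
  have := expR_gt0 x; rewrite WE; have [->|pn1] := eqVneq p 1; first by lra.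
  have : p < 1 by rewrite lt_neqAle pn1.
  have := mulr_ge0 p0 (expR_ge0 x); lra.
have dW (x : R) : is_derive x 1 W (p * expR x).
  rewrite -[p * _]add0r.
  exact: (is_deriveD (is_derive_cst _ _ _) (is_deriveZ p (is_derive_expR x))).
(* [p * expR x / W x] is the derivative of ln W; its own derivative s (1 - s) is
   at most 1/4. *)
have sl (x : R) : 0 <= x -> p * expR x / W x <= p + x / 4.
  move=> x0.
  pose S : R -> R := (p *: (@expR R)) * (fun y => (W y)^-1) - 4^-1 *: (@id R).
  have SE y : S y = p * expR y / W y - 4^-1 * y by [].
  have dS (y : R) : is_derive y 1 S
    ((p * expR y / W y) * (1 - p * expR y / W y) - 4^-1).
    have Wn : W y != 0 by rewrite gt_eqF.
    have dWV : is_derive y 1 (fun y => (W y)^-1) (- (W y) ^- 2 *: (p * expR y)).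
      exact: is_deriveV.
    apply: is_derive_eq; rewrite /GRing.scale /=.
    rewrite /GRing.scale /=.
    by field.
  have := is_derive_nincr dS _ x0.
  have sle y : (p * expR y / W y) * (1 - p * expR y / W y) - 4^-1 <= 0.
    by have := sqr_ge0 (p * expR y / W y - 2^-1); lra.
  move=> /(_ (fun y _ => sle y)).
  by rewrite !SE [W 0]WE expR0 mulr1 subrK divr1; lra.
pose q : R -> R := - (p *: (@id R) + 8^-1 *: ((@id R) ^+ 2)).
have dq (x : R) : is_derive x 1 q (- (p + x / 4)).
  have := is_deriveN (is_deriveD (is_deriveZ p (is_derive_id x 1))
    (is_deriveZ 8^-1 (is_deriveX 2 (is_derive_id x 1)))).
  move=> /is_derive_eq; apply.
  rewrite /GRing.scale /=; rewrite /GRing.scale /=.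
  by field.
pose G : R -> R := W * (expR \o q).
have GE x : G x = W x * expR (- (p * x + 8^-1 * x ^+ 2)) by [].
have dG (x : R) : is_derive x 1 G
   (expR (q x) * W x * (p * expR x / W x - (p + x / 4))).
  have Wn : W x != 0 by rewrite gt_eqF.
  have dE : is_derive x 1 (expR \o q) (expR (q x) * - (p + x / 4)).
    exact: (is_derive1_comp (is_derive_expR (q x)) (dq x)).
  have /is_derive_eq := is_deriveM (dW x) dE; apply.
  rewrite /GRing.scale /=.
  by field.
have := is_derive_nincr dG _ t0.
rewrite !GE !WE expr0n/= !mulr0 addr0 oppr0 expR0 !mulr1 subrK expRN => H.
rewrite -[leRHS]mul1r -ler_pdivrMr ?expR_gt0// (mulrC _ 8^-1).
apply: H => x x0; apply: mulr_ge0_le0; last by rewrite subr_le0 sl.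
by rewrite mulr_ge0 ?expR_ge0 ?ltW// W0.
Qed.

(** For t < 0, exchange the two outcomes of the Bernoulli variable. *)
Lemma bernoulli_mgf_le_all (R : realType) (p t : R) : 0 <= p <= 1 ->
  1 - p + p * expR t <= expR (p * t + t ^+ 2 / 8).
Proof.
move=> p01; have [|t0] := leP 0 t; first exact: bernoulli_mgf_le.
have q01 : 0 <= 1 - p <= 1 by lra.
have nt0 : 0 <= - t by rewrite oppr_ge0 ltW.
have := bernoulli_mgf_le q01 nt0.
(* Multiplying the bound for [1 - p] and [- t] by [expR t] restores the original variable. *)
rewrite -(ler_pM2l (expR_gt0 t)) -expRD expRN mulrDr mulrCA divff ?gt_eqF ?expR_gt0//.
move=> H; apply: le_trans (le_trans H _); first by lra.
by rewrite ler_expR sqrrN; lra.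
Qed.

(** * Hoeffding's inequality for two samples *)

Lemma sum_tuple_prod (R : comPzSemiRingType) (n t : nat) (F : 'I_n -> R) :
  \sum_(a : t.-tuple 'I_n) \prod_(s < t) F (tnth a s) = (\sum_i F i) ^+ t.
Proof.
rewrite -[in RHS](card_ord t) -prodr_const bigA_distr_bigA/=.
rewrite (reindex (@finfun_of_tuple 'I_n t))/=; last first.
  exists tuple_of_finfun => a _; [exact: finfun_of_tupleK|exact: tuple_of_finfunK].
by apply: eq_bigr => a _; apply: eq_bigr => s _; rewrite ffunE.
Qed.

(** Exchanging the sums over points and positions turns the empirical mass of [S] into a mean of
    indicators, one per sample. *)
Lemma empirical_sum (R : realType) (n t : nat) (S : {set 'I_n})
    (a : t.-tuple 'I_n) :
  \sum_(i in S) empirical R a i = (\sum_(s < t) (tnth a s \in S)%:R) / t%:R.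
Proof.
rewrite /empirical -mulr_suml; congr (_ / _).
under eq_bigr => i _ do rewrite -sum1_count big_tuple natr_sum.
rewrite (exchange_big_dep xpredT)//=; apply: eq_bigr => s _.
have [aS|aS] := boolP (tnth a s \in S).
  rewrite (big_pred1 (tnth a s))// => i /=; rewrite eq_sym.
  by case: eqP => [->|]; rewrite ?andbF// aS.
by rewrite big_pred0// => i; apply/negbTE/negP => /andP[iS /eqP ai]; rewrite ai iS in aS.
Qed.

Section Hoeffding.
Variables (R : realType) (n : nat).
Implicit Types (D : 'I_n -> R) (S : {set 'I_n}).

(** The probability of drawing [a] in this order from [D]; concentration is proved for finite sums
    against this weight and transferred to [P] later. *)
Definition tuple_weight (t : nat) D (a : t.-tuple 'I_n) : R :=
  \prod_(s < t) D (tnth a s).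

Lemma distribution_sum_le1 D S : is_distribution D -> 0 <= \sum_(i in S) D i <= 1.
Proof.
move=> [D0 D1]; rewrite sumr_ge0//= -D1 [leRHS](bigID (mem S))/= lerDl.
exact: sumr_ge0.
Qed.

Lemma tuple_weight_ge0 t D (a : t.-tuple 'I_n) :
  is_distribution D -> 0 <= tuple_weight D a.
Proof. by move=> [D0 _]; apply: prodr_ge0. Qed.

(** Under [D] the indicator of [S] is a Bernoulli variable whose parameter is the mass of [S]. *)
Lemma indicator_mgf_le D S (x : R) : is_distribution D ->
  \sum_i D i * expR (x * (i \in S)%:R) <=
  expR (x * (\sum_(i in S) D i) + x ^+ 2 / 8).
Proof.
move=> dD; have [D0 D1] := dD.
apply: le_trans (_ : 1 - \sum_(i in S) D i + (\sum_(i in S) D i) * expR x <= _); last first.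
  by rewrite (mulrC x); apply: bernoulli_mgf_le_all; exact: distribution_sum_le1.
have -> : 1 - \sum_(i in S) D i = \sum_(i | i \notin S) D i.
  by rewrite -D1 [X in X - _](bigID (mem S))/= addrAC subrr add0r.
rewrite (bigID (mem S))/= addrC mulr_suml; apply: lerD; apply: ler_sum => i iS.
  by rewrite (negbTE iS) mulr0 expR0 mulr1.
by rewrite iS mulr1.
Qed.

(** Both the weight and the exponential are products over positions, so the sum is the [t]-th power
    of the one-sample sum. *)
Lemma tuple_mgf_le t D S (x : R) : is_distribution D ->
  \sum_(a : t.-tuple 'I_n)
     tuple_weight D a * expR (x * \sum_(s < t) (tnth a s \in S)%:R) <=
  expR (t%:R * (x * (\sum_(i in S) D i) + x ^+ 2 / 8)).
Proof.
move=> dD; rewrite expRM_natl.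
under eq_bigr => a _.
  rewrite mulr_sumr expR_sum -big_split/=.
  over.
rewrite (sum_tuple_prod t (fun i => D i * expR (x * (i \in S)%:R))).
apply: lerXn2r; rewrite ?nnegrE ?expR_ge0//; last exact: indicator_mgf_le.
by apply: sumr_ge0 => i _; rewrite mulr_ge0 ?expR_ge0//; case: dD.
Qed.

(** Chernoff's method: the indicator of the event is at most the exponential of [t * y] times
    (deviation minus [x]), and the sum then factors into one generating function per sample. *)
Lemma hoeffding_two_sample t D1 D2 S (x : R) : (0 < t)%N -> 0 <= x ->
  is_distribution D1 -> is_distribution D2 ->
  \sum_(ab : t.-tuple 'I_n * t.-tuple 'I_n |
      x <= (\sum_(i in S) empirical R ab.1 i - \sum_(i in S) empirical R ab.2 i) -
           (\sum_(i in S) D1 i - \sum_(i in S) D2 i))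
    tuple_weight D1 ab.1 * tuple_weight D2 ab.2 <= expR (- (t%:R * x ^+ 2)).
Proof.
move=> t0 x0 dD1 dD2.
set p := \sum_(i in S) D1 i; set q := \sum_(i in S) D2 i.
pose cnt (a : t.-tuple 'I_n) : R := \sum_(s < t) (tnth a s \in S)%:R.
have tR : 0 < t%:R :> R by rewrite ltr0n.
(* y = 2 x minimizes the Chernoff exponent - t y x + t y^2 / 4. *)
pose y := 2 * x.
apply: le_trans (_ : \sum_(ab : t.-tuple 'I_n * t.-tuple 'I_n)
   expR (- (t%:R * y * (x + p - q))) *
   ((tuple_weight D1 ab.1 * expR (y * cnt ab.1)) *
    (tuple_weight D2 ab.2 * expR ((- y) * cnt ab.2))) <= _).
  rewrite big_mkcond/=; apply: ler_sum => -[a b] _ /=.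
  rewrite [X in _ <= _ * X]mulrACA -expRD [leRHS]mulrCA -expRD !empirical_sum -/(cnt a) -/(cnt b).
  have w0 := mulr_ge0 (tuple_weight_ge0 a dD1) (tuple_weight_ge0 b dD2).
  case: ifPn => [h|_]; last by rewrite mulr_ge0// expR_ge0.
  rewrite -[leLHS]mulr1 ler_wpM2l// -[leLHS]expR0 ler_expR.
  rewrite (_ : _ + _ = t%:R * y * (cnt a / t%:R - cnt b / t%:R - (p - q) - x)); last first.
    by field; rewrite gt_eqF.
  by rewrite !mulr_ge0 ?(ltW tR)// ?subr_ge0// /y; lra.
rewrite -mulr_sumr -(pair_bigA _ (fun a b =>
   (tuple_weight D1 a * expR (y * cnt a)) *
    (tuple_weight D2 b * expR ((- y) * cnt b))))/=.
under eq_bigr => a _ do rewrite -mulr_sumr.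
rewrite -mulr_suml.
have A1 := tuple_mgf_le t S y dD1; have A2 := tuple_mgf_le t S (- y) dD2.
have A0 D z : is_distribution D ->
    0 <= \sum_(a : t.-tuple 'I_n) tuple_weight D a * expR (z * cnt a).
  by move=> dD; apply: sumr_ge0 => a _; rewrite mulr_ge0 ?expR_ge0// tuple_weight_ge0.
apply: le_trans (_ : expR (- (t%:R * y * (x + p - q))) * (expR (t%:R * (y * p + y ^+ 2 / 8)) *
   expR (t%:R * (- y * q + (- y) ^+ 2 / 8))) <= _).
  by rewrite ler_wpM2l ?expR_ge0// ler_pM// A0.
rewrite -!expRD ler_expR le_eqVlt; apply/orP; left; apply/eqP.
by rewrite /y; field.
Qed.

End Hoeffding.

(** * Total variation as a maximum over sets *)

Section TotalVariation.
Variables (R : realType) (n : nat).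
Implicit Types (p q : 'I_n -> R).

(** Since [p - q] sums to 0, its sum over [S] is half of (sum over [S] minus sum over the
    complement). *)
Lemma sum_le_TV p q (S : {set 'I_n}) : \sum_i p i = \sum_i q i ->
  \sum_(i in S) p i - \sum_(i in S) q i <= TV p q.
Proof.
move=> pq; rewrite -sumrB /TV.
have : \sum_i (p i - q i) = 0 by rewrite sumrB pq subrr.
rewrite (bigID (mem S))/= [X in 2^-1 * X](bigID (mem S))/=.
have A : \sum_(i in S) (p i - q i) <= \sum_(i in S) `|p i - q i|.
  by apply: ler_sum => i _; exact: ler_norm.
have : - \sum_(i | i \notin S) (p i - q i) <= \sum_(i | i \notin S) `|p i - q i|.
  by rewrite -sumrN; apply: ler_sum => i _; rewrite -normrN ler_norm.
by lra.
Qed.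

(** On the set where [p] dominates [q], all the inequalities behind [sum_le_TV] are equalities. *)
Lemma TV_attained p q : \sum_i p i = \sum_i q i ->
  exists S : {set 'I_n}, TV p q = \sum_(i in S) p i - \sum_(i in S) q i.
Proof.
move=> pq; exists [set i | q i <= p i]%SET; rewrite -sumrB /TV.
have : \sum_i (p i - q i) = 0 by rewrite sumrB pq subrr.
rewrite (bigID (mem [set i | q i <= p i]%SET))/=.
rewrite [X in 2^-1 * X](bigID (mem [set i | q i <= p i]%SET))/=.
rewrite [X in _ * (X + _)](eq_bigr (fun i => p i - q i)); last first.
  by move=> i; rewrite inE => h; rewrite ger0_norm// subr_ge0.
rewrite [X in _ * (_ + X)](eq_bigr (fun i => - (p i - q i))); last first.
  by move=> i; rewrite inE -ltNge => h; rewrite ltr0_norm// subr_lt0.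
by rewrite sumrN; lra.
Qed.

Lemma empirical_total t (a : t.-tuple 'I_n) : (0 < t)%N ->
  \sum_i empirical R a i = 1.
Proof.
move=> t0; have := empirical_sum R [set: 'I_n]%SET a.
rewrite (eq_bigl xpredT); last by move=> i; rewrite inE.
under [in RHS]eq_bigr => s _ do rewrite inE.
by rewrite sumr_const card_ord divff// pnatr_eq0 -lt0n.
Qed.

Lemma empirical_distribution t (a : t.-tuple 'I_n) : (0 < t)%N ->
  is_distribution (empirical R a).
Proof.
move=> t0; split; last exact: empirical_total.
by move=> i; rewrite divr_ge0 ?ler0n.
Qed.

Lemma TV_le1 p q : is_distribution p -> is_distribution q -> TV p q <= 1.
Proof.
move=> dp dq; have [|S ->] := @TV_attained p q; first by case: dp dq => _ -> [_ ->].
have := distribution_sum_le1 S dp; have := distribution_sum_le1 S dq; lra.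
Qed.

End TotalVariation.

(** * Law of the samples *)

(** Taking the value itself as default makes this hold for every [i], also beyond [t]. *)
Lemma nth_first_samples (n : nat) (T : Type) (Y : nat -> T -> 'I_n) (t i : nat)
  (w : T) : Y i w = nth (Y i w) (first_samples Y t w) i.
Proof.
have [it|ti] := ltnP i t; last by rewrite nth_default ?size_tuple.
by rewrite -[i in RHS]/(nat_of_ord (Ordinal it)) -tnth_nth tnth_mktuple.
Qed.

Section SampleLaw.
Context {R : realType} {n : nat} {d : measure_display} {T : measurableType d}.
Variables (P : probability T R) (A B : nat -> T -> 'I_n) (D1 D2 : 'I_n -> R).
Hypothesis AB : iid_samples P A B D1 D2.

Definition sample_pair (t : nat) (w : T) : t.-tuple 'I_n * t.-tuple 'I_n :=
  (first_samples A t w, first_samples B t w).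

(** The event fixes the first [t] samples of each sequence, so it is a finite intersection to which
    independence applies. *)
Lemma sample_pair_atom t (ab : t.-tuple 'I_n * t.-tuple 'I_n) :
  measurable (sample_pair t @^-1` [set ab]) /\
  P (sample_pair t @^-1` [set ab]) =
    (tuple_weight D1 ab.1 * tuple_weight D2 ab.2)%:E.
Proof.
case: ab => a b; have [mAB PA PB indep] := AB.
pose s : seq (nat + nat) := map inl (index_iota 0 t) ++ map inr (index_iota 0 t).
pose X (k : nat + nat) := match k with inl i => A i | inr i => B i end.
(* [nth x _ i] takes [x] itself as default, since 'I_n may be empty. *)
pose E (k : nat + nat) : set 'I_n := match k with
  | inl i => [set x | x = nth x a i] | inr i => [set x | x = nth x b i] end.
have nthE (c : t.-tuple 'I_n) (i : 'I_t) : [set x | x = nth x c i] = [set tnth c i].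
  by apply/seteqP; split => x /=; rewrite -tnth_nth.
have mX k : measurable (X k @^-1` E k).
  by case: k => i; have [mA mB] := mAB i; [exact: mA|exact: mB].
have atomE : sample_pair t @^-1` [set (a, b)] = \bigcap_(k in [set` s]) (X k @^-1` E k).
  apply/seteqP; split => w /=.
    by move=> [aE bE] [i|i] _ /=; rewrite -?aE -?bE; exact: nth_first_samples.
  move=> H; rewrite /sample_pair; congr (_, _);
    apply/eq_from_tnth => i; rewrite tnth_mktuple.
    have /H/= : [set` s] (inl (val i)).
      by rewrite /= mem_cat map_f// mem_index_iota ltn_ord.
    by rewrite -tnth_nth.
  have /H/= : [set` s] (inr (val i)).
    by rewrite /= mem_cat [X in _ || X]map_f ?orbT// mem_index_iota ltn_ord.
  by rewrite -tnth_nth.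
rewrite atomE; split.
  by apply: fin_bigcap_measurable => [|k _]; [exact: finite_seq|exact: mX].
have us : uniq s.
  rewrite cat_uniq !map_inj_uniq ?iota_uniq; try by move=> ? ? [].
  by rewrite /= andbT; apply/hasPn => _ /mapP[i _ ->]; apply/negP => /mapP[].
rewrite (indep s E us) big_cat !big_map !big_mkord /tuple_weight EFinM -!prodEFin.
by congr (_ * _)%E; apply: eq_bigr => i _; rewrite [E _]nthE ?PA ?PB.
Qed.

(** The bridge from [P] to finite weighted sums: [sample_pair] has finitely many values, so any
    event about it is a finite disjoint union of atoms. *)
Lemma sample_pair_law t (Q : pred (t.-tuple 'I_n * t.-tuple 'I_n)) :
  measurable [set w | Q (sample_pair t w)] /\
  P [set w | Q (sample_pair t w)] =
    (\sum_(ab | Q ab) tuple_weight D1 ab.1 * tuple_weight D2 ab.2)%:E.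
Proof.
have -> : [set w | Q (sample_pair t w)] =
    \bigcup_(ab in [set ab | Q ab]) (sample_pair t @^-1` [set ab]).
  by apply/seteqP; split=> w /= => [Qw|[ab/= Qab ->]//]; exists (sample_pair t w).
have mA ab : measurable (sample_pair t @^-1` [set ab]) by case: (sample_pair_atom ab).
split; first by apply: fin_bigcup_measurable => //; exact: finite_finset.
rewrite measure_fin_bigcup; [|exact: finite_finset| |by []]; last first.
  by move=> x y _ _ [w [/= <- <-]].
rewrite fsbig_finite/=; last exact: finite_finset.
under eq_bigr => ab _ do rewrite (sample_pair_atom ab).2.
rewrite sumEFin; congr EFin; rewrite -[RHS]big_filter; apply: perm_big.
apply: uniq_perm; rewrite ?filter_uniq ?index_enum_uniq ?finmap.fset_uniq// => ab.
rewrite mem_filter mem_index_enum andbT in_fset_set; last exact: finite_finset.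
by apply/idP/idP => [/set_mem|Qab]; last exact: mem_set.
Qed.

End SampleLaw.

(** * Deviation of the empirical total variation *)

Section Deviation.
Context {R : realType} {n : nat} {d : measure_display} {T : measurableType d}.
Variables (P : probability T R) (A B : nat -> T -> 'I_n).

Lemma TV_ge_measurable D1 D2 t (x : R) : iid_samples P A B D1 D2 ->
  measurable [set w | x < tv_at R A B t w].
Proof.
move=> AB.
by have [] := sample_pair_law AB (t := t) (fun ab => x < TV (empirical R ab.1) (empirical R ab.2)).
Qed.

Lemma TV_le_measurable D1 D2 t (x : R) : iid_samples P A B D1 D2 ->
  measurable [set w | tv_at R A B t w <= x].
Proof.
move=> AB.
by have [] := sample_pair_law AB (t := t) (fun ab => TV (empirical R ab.1) (empirical R ab.2) <= x).
Qed.

Lemma TV_deviation_null D t (x : R) : is_distribution D ->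
  iid_samples P A B D D -> (0 < t)%N -> 0 <= x ->
  (P [set w | (x < tv_at R A B t w)%R] <= (2 ^+ n * expR (- (t%:R * x ^+ 2)))%:E)%E.
Proof.
move=> dD AB t0 x0.
have [_ ->] := sample_pair_law AB (t := t)
  (fun ab => x < TV (empirical R ab.1) (empirical R ab.2)).
rewrite lee_fin; pose w (ab : t.-tuple 'I_n * t.-tuple 'I_n) : R :=
  tuple_weight D ab.1 * tuple_weight D ab.2.
have w0 ab : 0 <= w ab by rewrite mulr_ge0// tuple_weight_ge0.
(* The last difference is 0; it is kept to match the event of [hoeffding_two_sample]. *)
pose dev (S : {set 'I_n}) ab := x <=
  (\sum_(i in S) @empirical R n t ab.1 i - \sum_(i in S) @empirical R n t ab.2 i) -
  (\sum_(i in S) D i - \sum_(i in S) D i).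
(* Union bound: a pair with large distance is counted at least once, through the set attaining that
   distance. *)
apply: le_trans (_ : \sum_ab \sum_(S | dev S ab) w ab <= _).
  rewrite big_mkcond/=; apply: ler_sum => -[a b] _ /=.
  case: ifPn => [xTV|_]; last by apply: sumr_ge0.
  have [|S TVS] := @TV_attained R n (empirical R a) (empirical R b).
    by rewrite !empirical_total.
  rewrite (bigD1 S)/= ?lerDl ?sumr_ge0//.
  by rewrite /dev subrr subr0 -TVS ltW.
rewrite (exchange_big_dep xpredT)//=.
apply: le_trans (_ : \sum_(S : {set 'I_n}) expR (- (t%:R * x ^+ 2)) <= _).
  by apply: ler_sum => S _; exact: hoeffding_two_sample.
rewrite sumr_const (_ : #|_| = (2 ^ n)%N) -?[leLHS]mulr_natl ?natrX//.
by rewrite -[X in (2 ^ X)%N]card_ord -[X in (2 ^ X)%N]cardsT -card_powerset powersetT cardsT.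
Qed.

(** On the set [S] attaining [TV D1 D2], the empirical difference is at most the empirical distance,
    so it falls short by at least [TV D1 D2 - x]. Passing to [~: S] changes the sign of both
    differences, which makes this an upward deviation. *)
Lemma TV_deviation_low D1 D2 t (x : R) : is_distribution D1 ->
  is_distribution D2 -> iid_samples P A B D1 D2 -> (0 < t)%N ->
  x <= TV D1 D2 ->
  (P [set w | (tv_at R A B t w <= x)%R] <=
     (expR (- (t%:R * (TV D1 D2 - x) ^+ 2)))%:E)%E.
Proof.
move=> dD1 dD2 AB t0 xTV.
have [_ ->] := sample_pair_law AB (t := t)
  (fun ab => TV (empirical R ab.1) (empirical R ab.2) <= x).
have sumD : \sum_i D1 i = \sum_i D2 i by case: dD1 dD2 => _ -> [_ ->].
have [S TVS] := TV_attained sumD.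
have setC_sum D : is_distribution D -> \sum_(i in ~: S) D i = 1 - \sum_(i in S) D i.
  case=> _ <-; rewrite [in RHS](bigID (mem S))/= addrAC subrr add0r.
  by apply: eq_bigl => i; rewrite inE.
rewrite lee_fin; have y0 : 0 <= TV D1 D2 - x by rewrite subr_ge0.
apply: le_trans (hoeffding_two_sample (~: S) t0 y0 dD1 dD2).
rewrite [leLHS]big_mkcond [leRHS]big_mkcond/=; apply: ler_sum => -[a b] _ /=.
have w0 : 0 <= tuple_weight D1 a * tuple_weight D2 b.
  by rewrite mulr_ge0// tuple_weight_ge0.
case: ifPn => [TVx|_]; last by case: ifP.
suff -> : TV D1 D2 - x <=
  (\sum_(i in ~: S) empirical R a i - \sum_(i in ~: S) empirical R b i) -
  (\sum_(i in ~: S) D1 i - \sum_(i in ~: S) D2 i) by [].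
rewrite !setC_sum//; try exact: empirical_distribution.
have := @sum_le_TV R n (empirical R a) (empirical R b) S.
rewrite !empirical_total// => /(_ erefl).
by lra.
Qed.

End Deviation.

(** * Correctness *)

Lemma nneseries_le_bound (R : realType) (u : nat -> \bar R) (N : nat) (c : \bar R) :
  (forall k, (N <= k)%N -> 0 <= u k)%E ->
  (forall m, (N <= m)%N -> \sum_(N <= k < m) u k <= c)%E ->
  (\sum_(N <= k <oo) u k <= c)%E.
Proof.
move=> u0 uc; apply: lime_le; first by apply: is_cvg_nneseries => k Nk _; exact: u0.
by exists N => // m /= Nm; exact: uc.
Qed.

Lemma sum_inv_consecutive (R : realFieldType) (N m : nat) : (0 < N <= m)%N ->
  \sum_(N <= t < m) (t%:R * t.+1%:R)^-1 = N%:R^-1 - m%:R^-1 :> R.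
Proof.
move=> /andP[N0 Nm]; rewrite (@telescope_sumr_eq _ N m (fun t => - t%:R^-1)) ?opprK 1?addrC//.
move=> t /andP[Nt _]; have t0 : t%:R != 0 :> R by rewrite pnatr_eq0 -lt0n (leq_trans N0).
have t1 : t.+1%:R != 0 :> R by rewrite pnatr_eq0.
by rewrite -natr1 in t1 *; field; rewrite t0 t1.
Qed.

(** Union bound over the times from [N] on: the series of 1 / (t (t + 1)) telescopes to 1 / N. *)
Lemma measure_union_le_inv {R : realType} {d : measure_display}
    {T : measurableType d} (P : probability T R) (E : set T) (F : nat -> set T)
    (N : nat) (c : R) : (0 < N)%N -> 0 <= c ->
  measurable E -> (forall t, measurable (F t)) ->
  E `<=` \bigcup_(t in ~` `I_N) F t ->
  (forall t, (N <= t)%N -> (P (F t) <= (c / (t%:R * t.+1%:R))%:E)%E) ->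
  (P E <= (c / N%:R)%:E)%E.
Proof.
move=> N0 c0 mE mF EF PF.
apply: le_trans (measure_sigma_subadditive_tail P mF mE EF) _.
apply: nneseries_le_bound => [//|m Nm].
apply: (@le_trans _ _ (\sum_(N <= t < m) (c / (t%:R * t.+1%:R))%:E)%E).
  by rewrite big_nat [leRHS]big_nat; apply: lee_sum => t /andP[Nt _]; exact: PF.
rewrite sumEFin lee_fin -mulr_sumr sum_inv_consecutive ?N0//.
by rewrite ler_wpM2l// lerBlDr lerDl invr_ge0.
Qed.

Lemma outputs_measurable {R : realType} {n : nat} {d : measure_display}
    {T : measurableType d} (P : probability T R) (A B : nat -> T -> 'I_n)
    (D1 D2 : 'I_n -> R) (alg : sequential_test n) (v : decision) :
  iid_samples P A B D1 D2 -> measurable (outputs alg A B v).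
Proof.
move=> AB.
have md t u : measurable [set w | decision_at alg A B t w = u].
  have [+ _] := sample_pair_law AB (t := t) (fun ab => `[< alg t ab.1 ab.2 = u >]).
  by congr measurable; apply/seteqP; split => w /=; rewrite asboolE.
have -> : outputs alg A B v = \bigcup_(t in [set t | (0 < t)%N])
    ([set w | decision_at alg A B t w = v] `&`
     \bigcap_(s in [set s | (0 < s < t)%N]) [set w | decision_at alg A B s w = Continue]).
  by apply/seteqP; split => [w [t [t0 tv ts]]|w [t t0 [tv ts]]]; exists t.
apply: bigcup_measurable => t _; apply: measurableI => //.
by apply: bigcap_measurableType => s _.
Qed.

(** The tangent bound at - 1/2 gives e^(-1/2) >= 1/2; squaring it gives e^(-1) >= 1/4. *)
Lemma expR1_le4 (R : realType) : expR 1 <= 4 :> R.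
Proof.
have h : 2^-1 <= expR (- 2^-1) :> R by have := expR_ge1Dx (- 2^-1 : R); lra.
have h2 : 4^-1 <= expR (- 2^-1) * expR (- 2^-1) :> R.
  have -> : 4^-1 = 2^-1 * 2^-1 :> R by field.
  by apply: ler_pM; rewrite ?invr_ge0.
have : expR 1 * (expR (- 2^-1) * expR (- 2^-1)) = 1 :> R.
  by rewrite -!expRD (_ : 1 + _ = 0) ?expR0//; field.
move=> e1; have := expR_ge0 (1 : R); move/ler_wpM2l => /(_ _ _ h2).
by rewrite e1; lra.
Qed.

Section Phi.
Context {R : realType}.
Variables (n : nat) (delta : R).
Hypothesis delta01 : 0 < delta < 1.

Lemma Phi_ge0 t : 0 <= Phi n delta t.
Proof. exact: sqrtr_ge0. Qed.

Lemma Phi_arg_ge t : (0 < t)%N -> 1 <= 2 ^+ n.-1 * t%:R * t.+1%:R / delta.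
Proof.
move=> t0; have /andP[d0 d1] := delta01.
rewrite ler_pdivlMr// mul1r (le_trans (ltW d1))//.
by rewrite !mulr_ege1// ?exprn_ege1 ?ler1n.
Qed.

Lemma Phi_sqr t : (0 < t)%N ->
  t%:R * Phi n delta t ^+ 2 = ln (2 ^+ n.-1 * t%:R * t.+1%:R / delta).
Proof.
move=> t0; rewrite sqr_sqrtr; last by rewrite divr_ge0 ?ln_ge0 ?Phi_arg_ge.
by rewrite mulrC divfK// pnatr_eq0 -lt0n.
Qed.

(** [Phi] is chosen so that Hoeffding's bound becomes summable over time. *)
Lemma expR_Phi t : (0 < t)%N -> expR (- (t%:R * Phi n delta t ^+ 2)) =
  delta / 2 ^+ n.-1 / (t%:R * t.+1%:R).
Proof.
move=> t0; rewrite Phi_sqr// expRN lnK ?posrE ?(lt_le_trans _ (Phi_arg_ge t0))//.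
by rewrite invf_div -mulrA invfM mulrA.
Qed.

(** The logarithm is taken of a number above 4 >= e. This rules out [Output2] at time 1, where the
    distance is at most 1. *)
Lemma Phi1_gt1 : (2 <= n)%N -> 1 < Phi n delta 1.
Proof.
move=> n2; have /andP[d0 d1] := delta01.
have e4 := expR1_le4 R.
have lt4 : 4 < 2 ^+ n.-1 * 1%:R * 2%:R / delta :> R.
  rewrite mulr1 ltr_pdivlMr//.
  have : 2 <= 2 ^+ n.-1 :> R.
    by rewrite -[leLHS]expr1 ler_weXn2l// ?ler1n// -ltnS prednK// (leq_trans _ n2).
  by lra.
have h : 1 < ln (2 ^+ n.-1 * 1%:R * 2%:R / delta) / 1%:R :> R.
  rewrite divr1 -[ltLHS]expRK ltr_ln ?posrE ?expR_gt0//; first exact: le_lt_trans lt4.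
  exact: lt_trans lt4.
by rewrite /Phi -[ltLHS]sqrtr1 ltr_sqrt// (lt_trans _ h).
Qed.

End Phi.

Lemma algorithm2_delta_correct (R : realType) (n : nat) (eps delta : R) :
  (2 <= n)%N -> 0 < delta < 1 ->
  delta_correct (@algorithm2 R n eps delta) eps delta.
Proof.
move=> n2 delta01 d T P A B D1 D2 dD1 dD2 AB.
have /andP[d0 d1] := delta01.
have mO v := outputs_measurable (algorithm2 eps delta) v AB.
split=> [D12|epsTV].
  (* Each time costs 2 delta / (t (t + 1)); starting the sum at 2 recovers the factor 2. *)
  rewrite [X in (_ <= X%:E)%E](_ : delta = 2 * delta / 2%:R); last by field.
  apply: (@measure_union_le_inv _ _ _ P _
    (fun t => [set w | Phi n delta t < tv_at R A B t w])) => //.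
  - by rewrite mulr_ge0// ltW.
  - by move=> t; exact: TV_ge_measurable AB.
  - move=> w [t [t0 + _]]; rewrite /decision_at /algorithm2.
    case: ifPn => [h _|_]; last by case: ifP.
    (* A stop at a time below 2 would be at time 1, which [Phi1_gt1] excludes. *)
    exists t => //= t2.
    have t1E : t = 1%N by apply/eqP; rewrite eqn_leq t0 andbT -ltnS.
    move: h; rewrite t1E => /(lt_trans (Phi1_gt1 delta01 n2)); apply/negP.
    by rewrite -leNgt TV_le1//; exact: empirical_distribution.
  - move=> t t2; have t0 : (0 < t)%N by rewrite (leq_trans _ t2).
    subst D2.
    apply: le_trans (TV_deviation_null dD1 AB t0 (Phi_ge0 _ _ _)) _.
    rewrite lee_fin expR_Phi// !mulrA ler_wpM2r ?invr_ge0 ?ler0n//.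
    rewrite -[in leLHS](prednK (ltnW n2)) exprS.
    rewrite le_eqVlt; apply/orP; left; apply/eqP.
    by field; rewrite expf_neq0.
(* No union over sets here, so the factor 1 / 2^(n-1) survives and the sum may start at 1. *)
apply: le_trans (_ : ((delta / 2 ^+ n.-1 / 1%:R)%:E <= _)%E).
  apply: (@measure_union_le_inv _ _ _ P _
    (fun t => [set w | tv_at R A B t w <= TV D1 D2 - Phi n delta t])) => //.
  - by rewrite divr_ge0 ?exprn_ge0// ltW.
  - by move=> t; exact: TV_le_measurable AB.
  - move=> w [t [t0 + _]]; rewrite /decision_at /algorithm2.
    case: ifPn => [//|_]; case: ifPn => // h _.
    exists t => /=; first by apply/negP; rewrite -leqNgt.
    (* The threshold [eps - Phi] lies below [TV D1 D2 - Phi]. *)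
    by rewrite (le_trans h)// lerD2r ltW.
  - move=> t t0.
    rewrite -(expR_Phi n delta01)//.
    have := @TV_deviation_low _ _ _ _ _ _ _ _ _ _ (TV D1 D2 - Phi n delta t) dD1 dD2 AB t0.
    by rewrite gerBl Phi_ge0 subKr; exact.
by rewrite divr1 lee_fin ler_pdivrMr ?exprn_gt0// ler_peMr ?(ltW d0)// exprn_ege1// ler1n.
Qed.

(** * Expected stopping time *)

(** Unlike [ge0_le_integral], no measurability is assumed: it would be tedious
    to prove for the stopping time. *)
Lemma ge0_integral_mono {R : realType} {d : measure_display}
    {T : measurableType d} (mu : {measure set T -> \bar R}) (f g : T -> \bar R) :
  (forall x, 0 <= f x)%E -> (forall x, f x <= g x)%E ->
  (\int[mu]_x f x <= \int[mu]_x g x)%E.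
Proof.
move=> f0 fg; have g0 x : (0 <= g x)%E := le_trans (f0 x) (fg x).
rewrite !ge0_integralTE//; apply: le_ereal_sup => _ [h hf <-].
by exists h => // x; exact: le_trans (hf x) (fg x).
Qed.

Section StoppingTime.
Context {R : realType} {d : measure_display} {T : measurableType d}.
Variables (P : probability T R) (G : nat -> set T) (N : nat).
Hypotheses (mG : forall t, measurable (G t)) (N0 : (0 < N)%N).

Let tau (w : T) : \bar R :=
  ereal_inf [set t%:R%:E | t in [set t : nat | (0 < t)%N /\ G t w]].

(** The number of times from [N] on at which the criterion fails; its integral is a series of
    probabilities. *)
Let miss (w : T) : \bar R :=
  (\sum_(0 <= k <oo) (\1_(~` G (N + k)) w)%:E)%E.

Lemma partial_miss_le (w : T) (m : nat) :
  (forall k, (k < m)%N -> ~ G (N + k) w) -> (m%:R%:E <= miss w)%E.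
Proof.
move=> nG; apply: le_trans (nneseries_lim_ge m _); last first.
  by move=> k _; rewrite lee_fin.
rewrite sumEFin lee_fin big_mkord -[in leLHS](card_ord m) -sum1_card natr_sum.
by apply: ler_sum => k _; rewrite indicE mem_set// => /nG; apply.
Qed.

(** If [N + m] is the first success from [N] on, the [m] failures before it are counted by [miss];
    without any success [miss] is infinite. *)
Lemma stopping_time_le_miss (w : T) : (tau w <= N%:R%:E + miss w)%E.
Proof.
have miss0 : (0 <= miss w)%E by apply: nneseries_ge0 => k _ _; rewrite lee_fin.
have [[k Gk]|nG] := pselect (exists k, `[< G (N + k) w >]).
  have ex : exists k, `[< G (N + k) w >] by exists k.
  case: (ex_minnP ex) => m /asboolP Gm mmin.
  apply: (@le_trans _ _ (N + m)%:R%:E).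
    by apply: ereal_inf_lbound; exists (N + m)%N => //; split; rewrite // addn_gt0 N0.
  rewrite natrD EFinD leeD2l// partial_miss_le// => j jm Gj.
  by have := mmin j; rewrite asboolT// => /(_ isT); rewrite leqNgt jm.
have nG' k : ~ G (N + k) w by move=> Gk; apply: nG; exists k; exact/asboolP.
case: (miss w) miss0 (fun m => @partial_miss_le w m (fun k _ => nG' k)) => [c| |] //.
  move=> _ /(_ (Num.Def.truncn c).+1); rewrite lee_fin => h.
  by have := truncnS_gt c; rewrite ltNge h.
by move=> _ _; rewrite addey// leey.
Qed.

(** Integrate [stopping_time_le_miss], exchanging integral and series of nonnegative terms. *)
Lemma stopping_time_integral_le (v : nat -> R) (c : R) :
  (forall k, (P (~` G (N + k)) <= (v k)%:E)%E) ->
  (forall m, \sum_(0 <= k < m) v k <= c) ->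
  (\int[P]_w ereal_inf [set t%:R%:E | t in [set t : nat | (0 < t)%N /\ G t w]] <=
    (N%:R + c)%:E)%E.
Proof.
move=> Pv vc.
have mC k : measurable (~` G (N + k)) by exact: measurableC.
have mI k : measurable_fun setT (fun w => (\1_(~` G (N + k)) w)%:E : \bar R).
  by apply/measurable_EFinP; exact: measurable_indic.
have I0 k w : (0 <= (\1_(~` G (N + k)) w)%:E :> \bar R)%E by rewrite lee_fin.
apply: le_trans (ge0_integral_mono P (g := fun w => N%:R%:E + miss w)%E _ _) _.
- by move=> w; apply: le_ereal_inf_tmp => _ [t _ <-]; rewrite lee_fin.
- exact: stopping_time_le_miss.
rewrite ge0_integralD//=; last 2 first.
- by move=> w _; apply: nneseries_ge0.
- by apply: ge0_emeasurable_sum.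
rewrite integral_cst//= [X in (_ * X + _)%E]probability_setT mule1 EFinD leeD2l// integral_nneseries//.
apply: nneseries_le_bound => [k _|m _].
  exact: integral_ge0.
apply: (@le_trans _ _ (\sum_(0 <= k < m) (v k)%:E)%E).
  by apply: lee_sum => k _; rewrite integral_indic// setIT; exact: Pv.
by rewrite sumEFin lee_fin.
Qed.

End StoppingTime.

(** * Absorption of the logarithmic terms and a geometric series *)

Lemma ln_le_linear (R : realType) (u b : R) : 0 < u -> 0 < b ->
  ln u <= u / b + b.
Proof.
(* Split ln u = ln (u / b) + ln b and use ln x <= x on each term. *)
move=> u0 b0; rewrite -[in leLHS](divfK (lt0r_neq0 b0) u) lnM ?posrE ?divr_gt0//.
by apply: lerD; apply/ltW/ln_sublinear; rewrite ?divr_gt0.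
Qed.

(** Here [u] stands for t e^2. After multiplication by (1 + c/l)^2 = 1 + O(1/l), the cubic term
    grows by O(l^2) and the logarithm costs u / (2 l) + O(l). [K] doubles the resulting coefficients
    of l^2, because subtracting u / (2 l) may consume half of K l^2. *)
Lemma log_absorption (R : realType) (C0 c l u : R) : 0 < C0 -> 1 <= c -> 1 <= l ->
  let M := (1 + c) ^+ 2 in
  let K := 2 * (M + 4 * C0 * M + 8 * M ^+ 2) + 1 + 2 * C0 in
  l ^+ 3 + K * l ^+ 2 <= u ->
  l ^+ 3 + 4 * C0 * l ^+ 2 + 2 * ln u <= u * (l / (l + c)) ^+ 2.
Proof.
move=> C00 c1 l1 M K u0u.
have M4 : 4 <= M by rewrite /M; nra.
have l0 : 0 < l by lra.
have l3 : 1 <= l ^+ 3 by rewrite exprn_ege1.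
have l2 : l <= l ^+ 2 by rewrite expr2; nra.
have K0 : 0 <= K by rewrite /K; nra.
have u1 : 1 <= u.
  by apply: le_trans u0u; have := mulr_ge0 K0 (sqr_ge0 l); lra.
have lnu0 : 0 <= ln u by exact: ln_ge0.
have b0 : 0 < 4 * M * l by rewrite !mulr_gt0//; lra.
(* Choosing b = 4 M l makes the logarithm cost only u / (2 l) below. *)
have lnu := ln_le_linear (lt_le_trans ltr01 u1) b0.
have lc : (l / (l + c)) ^+ 2 * (1 + c / l) ^+ 2 = 1.
  by rewrite -exprMn (_ : l / (l + c) * (1 + c / l) = 1) ?expr1n//; field; lra.
have f0 : 0 < (1 + c / l) ^+ 2 by rewrite exprn_gt0// addr_gt0// divr_gt0//; lra.
rewrite -(ler_pM2r f0) -[leRHS]mulrA lc mulr1.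
pose r := l^-1; have r0 : 0 < r by rewrite invr_gt0.
have r1 : r <= 1 by rewrite invf_le1.
have rl : r * l = 1 by rewrite mulVf// gt_eqF.
have fM : (1 + c / l) ^+ 2 <= 1 + (M - 1) * r.
  rewrite -/r /M; have : c * r * (c * r) <= c * c * r by nra.
  by rewrite !expr2; lra.
have fM' : (1 + c / l) ^+ 2 <= M by apply: le_trans fM _; nra.
have step1 : (l ^+ 3 + 4 * C0 * l ^+ 2) * (1 + c / l) ^+ 2 <=
    l ^+ 3 + (M + 4 * C0 * M) * l ^+ 2.
  have e1 : l ^+ 3 * (1 + c / l) ^+ 2 <= l ^+ 3 + M * l ^+ 2.
    apply: le_trans (_ : l ^+ 3 * (1 + (M - 1) * r) <= _).
      by rewrite ler_wpM2l// exprn_ge0// ltW.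
    have -> : l ^+ 3 * (1 + (M - 1) * r) = l ^+ 3 + (M - 1) * l ^+ 2 * (r * l).
      by ring.
    by rewrite rl; have := sqr_ge0 l; lra.
  have e2 : 4 * C0 * l ^+ 2 * (1 + c / l) ^+ 2 <= 4 * C0 * l ^+ 2 * M.
    by rewrite ler_wpM2l// mulr_ge0 ?sqr_ge0//; lra.
  by lra.
have step2 : 2 * ln u * (1 + c / l) ^+ 2 <= u * r / 2 + 8 * M ^+ 2 * l.
  apply: le_trans (_ : 2 * (u / (4 * M * l) + 4 * M * l) * M <= _).
    by apply: ler_pM; [exact: mulr_ge0|exact: sqr_ge0|rewrite ler_pM2l|].
  rewrite le_eqVlt; apply/orP; left; apply/eqP; rewrite /r.
  by field; lra.
(* The factor [1 - r / 2] is what remains of [u] once the logarithm has taken [u * r / 2]. *)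
have step3 : (l ^+ 3 + K * l ^+ 2) * (1 - r / 2) <= u * (1 - r / 2).
  by rewrite ler_wpM2r//; lra.
have e3 : (l ^+ 3 + K * l ^+ 2) * (1 - r / 2) =
    l ^+ 3 + K * l ^+ 2 - (l ^+ 2 + K * l) / 2 * (r * l) by ring.
rewrite e3 rl mulr1 in step3.
have Kl : K * l <= K * l ^+ 2 by rewrite ler_wpM2l.
have Ml : M ^+ 2 * l <= M ^+ 2 * l ^+ 2 by rewrite ler_wpM2l// sqr_ge0.
have C0l : 0 <= C0 * l ^+ 2 by rewrite mulr_ge0 ?sqr_ge0// ltW.
have KE : K * l ^+ 2 = 2 * ((M + 4 * C0 * M) * l ^+ 2 + 8 * (M ^+ 2 * l ^+ 2)) + l ^+ 2 + 2 * (C0 * l ^+ 2).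
  by rewrite /K; ring.
lra.
Qed.

(** The ratio q = e^(-x) satisfies q (1 + x) <= 1, hence 1 / (1 - q) <= (1 + x) / x. *)
Lemma geometric_sum_expR_le (R : realType) (x : R) (m : nat) : 0 < x ->
  \sum_(0 <= k < m) expR (- (k%:R * x)) <= 1 + x^-1.
Proof.
move=> x0; pose q := expR (- x).
have q0 : 0 < q by exact: expR_gt0.
have qx : q * (1 + x) <= 1.
  have := expR_ge1Dx x; rewrite -(ler_pM2l q0) => /le_trans; apply.
  by rewrite -expRD addNr expR0.
under eq_bigr => k _ do rewrite -mulrN expRM_natl -/q.
have S0 : 0 <= \sum_(0 <= k < m) q ^+ k by apply: sumr_ge0 => k _; rewrite exprn_ge0// ltW.
have : (1 - q) * \sum_(0 <= k < m) q ^+ k <= 1.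
  by rewrite big_mkord -opprB mulNr -subrX1 opprB lerBlDr lerDl exprn_ge0// ltW.
set S := \sum_(_ <= _ < _) _ in S0 * => h.
have -> : 1 + x^-1 = (1 + x) / x by field; lra.
rewrite ler_pdivlMr//.
have q1 : 0 <= 1 - q * (1 + x) by lra.
have := mulr_ge0 S0 q1.
have x10 : 0 <= 1 + x by lra.
move: h => /(ler_wpM2l x10).
lra.
Qed.

Lemma two_pow_le_expR (R : realType) (n : nat) : 2 ^+ n <= expR n%:R :> R.
Proof.
rewrite -[n%:R]mulr1 expRM_natl lerXn2r ?nnegrE ?expR_ge0//.
by have := expR_ge1Dx (1 : R); lra.
Qed.

(** * Sample complexity with explicit constants *)

Section SampleComplexity.
Context {R : realType}.
Variables (n : nat) (delta C0 e : R).
Hypotheses (n2 : (2 <= n)%N) (delta01 : 0 < delta < 1) (C00 : 0 < C0)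
  (e01 : 0 < e <= 1)
  (n_small : n%:R <= C0 * (ln delta^-1) `^ (3^-1))
  (e_large : ln e^-1 <= C0 * (ln delta^-1) `^ (2 / 3)).

Let L := ln (2 ^+ n.+1 / delta).
Let l := L `^ 3^-1.
(** [c], [M] and [K] depend on [C0] alone, which makes the final constant uniform. The choice of [c]
    ensures c >= 1 and c^2 >= 2 C0. *)
Let c := 1 + 2 * C0.
Let M := (1 + c) ^+ 2.
Let K := 2 * (M + 4 * C0 * M + 8 * M ^+ 2) + 1 + 2 * C0.
Let u0 := l ^+ 3 + K * l ^+ 2.
Let N := (Num.Def.truncn (u0 / e ^+ 2)).+1.

Let e0 : 0 < e. Proof. by case/andP: e01. Qed.
Let d0 : 0 < delta. Proof. by case/andP: delta01. Qed.
Let d1 : delta < 1. Proof. by case/andP: delta01. Qed.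
Let c1 : 1 <= c. Proof. by rewrite /c; have := C00; lra. Qed.

Let L_ge1 : 1 <= L.
Proof.
rewrite -[leLHS](@expRK R) ler_ln ?posrE ?expR_gt0// ?divr_gt0 ?exprn_gt0//.
rewrite ler_pdivlMr//.
have : 2 ^+ 2 <= 2 ^+ n.+1 :> R by rewrite ler_weXn2l ?ler1n// ltnW.
have := expR1_le4 R; have := expR_gt0 (1 : R).
by rewrite expr2; have := d0; have := d1; nra.
Qed.

Let ln_delta_ge0 : 0 <= ln delta^-1.
Proof. by rewrite ln_ge0// invf_ge1// ltW. Qed.

Let ln_delta_le : ln delta^-1 <= L.
Proof.
rewrite ler_ln ?posrE ?invr_gt0 ?divr_gt0 ?exprn_gt0//.
by rewrite ler_peMl ?invr_ge0 ?(ltW d0)// exprn_ege1// ler1n.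
Qed.

Let l_cube : l ^+ 3 = L.
Proof.
rewrite -powR_mulrn ?powR_ge0// -powRrM mulVf ?pnatr_eq0// powRr1//.
exact: le_trans L_ge1.
Qed.

Let l_sqr : l ^+ 2 = L `^ (2 / 3).
Proof. by rewrite -powR_mulrn ?powR_ge0// -powRrM mulrC. Qed.

Let l_ge1 : 1 <= l.
Proof.
apply: le_trans (_ : 1 `^ 3^-1 <= _); first by rewrite powR1.
by rewrite ge0_ler_powR ?nnegrE ?invr_ge0// (le_trans _ L_ge1).
Qed.

Let n_le : n%:R <= C0 * l.
Proof.
apply: le_trans n_small _; rewrite ler_pM2l//.
by rewrite ge0_ler_powR ?nnegrE ?invr_ge0// (le_trans _ L_ge1).
Qed.

Let ln_e_le : ln e^-1 <= C0 * l ^+ 2.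
Proof.
apply: le_trans e_large _; rewrite ler_pM2l// l_sqr.
by rewrite ge0_ler_powR ?nnegrE ?divr_ge0// (le_trans _ L_ge1).
Qed.

Let M_ge0 : 0 <= M. Proof. exact: sqr_ge0. Qed.

Let K_ge : 2 * C0 <= K.
Proof. by rewrite /K; have := mulr_ge0 (ltW C00) M_ge0; have := sqr_ge0 M; have := M_ge0; lra. Qed.

Let e2_gt0 : 0 < e ^+ 2. Proof. exact: exprn_gt0. Qed.

Let u0_ge0 : 0 <= u0 / e ^+ 2.
Proof.
rewrite divr_ge0 ?(ltW e2_gt0)// addr_ge0 ?mulr_ge0 ?exprn_ge0//; try exact: le_trans l_ge1.
by apply: le_trans K_ge; rewrite mulr_ge0// ltW.
Qed.

Let N_gt : u0 / e ^+ 2 < N%:R. Proof. exact: truncnS_gt. Qed.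

Let N_le : N%:R <= u0 / e ^+ 2 + 1.
Proof. by rewrite -natr1 lerD2r; have /andP[] := truncn_itv u0_ge0. Qed.

(** With u = t e^2, 2 ln t = 2 ln u + 4 ln (1/e) <= 2 ln u + 4 C0 l^2, so [log_absorption] applies
    from [N] on. *)
Lemma Phi_le_margin t : (N <= t)%N -> Phi n delta t <= e * (l / (l + c)).
Proof.
move=> Nt; have t0 : (0 < t)%N by apply: leq_trans Nt.
have tR : 0 < t%:R :> R by rewrite ltr0n.
have l0 : 0 < l := lt_le_trans ltr01 l_ge1.
have lc0 : 0 < l + c by have := c1; lra.
have u0u : u0 <= t%:R * e ^+ 2.
  by rewrite -ler_pdivrMr// (le_trans (ltW N_gt))// ler_nat.
have absorb := log_absorption C00 c1 l_ge1 u0u.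
rewrite -(@ler_sqr R) ?nnegrE ?Phi_ge0//; last by rewrite mulr_ge0 ?divr_ge0 ?(ltW e0) ?(ltW l0) ?(ltW lc0).
rewrite [leRHS]exprMn -(ler_pM2l tR) Phi_sqr// mulrA; apply: le_trans absorb.
rewrite l_cube lnM ?posrE// lnXn//.
(* Bounding t + 1 by 4 t produces exactly the argument of [L], times t^2. *)
have : ln (2 ^+ n.-1 * t%:R * t.+1%:R / delta) <= ln (2 ^+ n.+1 / delta * t%:R ^+ 2) :> R.
  rewrite ler_ln ?posrE ?mulr_gt0 ?invr_gt0 ?exprn_gt0 ?ltr0n//.
  rewrite [leRHS]mulrAC ler_pM2r ?invr_gt0//.
  have -> : 2 ^+ n.+1 = 2 * (2 * 2 ^+ n.-1) :> R by rewrite -!exprS prednK// ltnW.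
  have -> : 2 * (2 * 2 ^+ n.-1) * t%:R ^+ 2 = 2 ^+ n.-1 * t%:R * (4 * t%:R) :> R by ring.
  rewrite ler_wpM2l ?mulr_ge0 ?exprn_ge0// -natr1.
  have : 1 <= t%:R :> R by rewrite ler1n.
  by lra.
rewrite [X in _ <= X -> _]lnM ?posrE ?divr_gt0 ?exprn_gt0// lnXn// -/L.
have := ln_e_le; rewrite lnV ?posrE// !mulr2n.
move: (ln t%:R) (ln e) (ln _) (l ^+ 2) L => a b f g h.
by lra.
Qed.

(** By [Phi_le_margin] the margin is at least e c / (l + c). In the exponent, the [N] part pays for
    2^n <= e^n and the [k] part remains. *)
Lemma deviation_decay k :
  2 ^+ n * expR (- ((N + k)%:R * (e - Phi n delta (N + k)) ^+ 2)) <=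
  expR (- (k%:R * (e * (c / (l + c))) ^+ 2)).
Proof.
have l0 : 0 < l := lt_le_trans ltr01 l_ge1.
have lc0 : 0 < l + c by have := c1; lra.
have c0 : 0 < c := lt_le_trans ltr01 c1.
apply: le_trans (ler_wpM2r (expR_ge0 _) (two_pow_le_expR R n)) _.
rewrite -expRD ler_expR.
have ePhi : e * (c / (l + c)) <= e - Phi n delta (N + k).
  have -> : e * (c / (l + c)) = e - e * (l / (l + c)) by field; lra.
  by rewrite lerD2l lerN2 Phi_le_margin// leq_addr.
have eta0 : 0 <= e * (c / (l + c)) by rewrite mulr_ge0 ?divr_ge0// ltW.
have h1 : (N + k)%:R * (e * (c / (l + c))) ^+ 2 <= (N + k)%:R * (e - Phi n delta (N + k)) ^+ 2.
  by rewrite ler_wpM2l// ler_sqr ?nnegrE// (le_trans eta0).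
have h2 : n%:R <= N%:R * (e * (c / (l + c))) ^+ 2.
  apply: le_trans (_ : u0 / e ^+ 2 * (e * (c / (l + c))) ^+ 2 <= _); last first.
    by rewrite ler_wpM2r ?sqr_ge0// ltW.
  apply: le_trans n_le _.
  have -> : u0 / e ^+ 2 * (e * (c / (l + c))) ^+ 2 = u0 * c ^+ 2 / (l + c) ^+ 2.
    by field; rewrite !gt_eqF.
  rewrite ler_pdivlMr ?exprn_gt0//.
  (* Since n <= C0 l and (l + c)^2 <= 2 l^2 + 2 c^2, it suffices to compare terms: c^2 >= 2 C0
     handles l^3, and K >= 2 C0 handles l c^2. *)
  have c2 : 2 * C0 <= c ^+ 2 by rewrite /c; have := C00; nra.
  apply: le_trans (_ : C0 * l * (2 * l ^+ 2 + 2 * c ^+ 2) <= _).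
    rewrite ler_wpM2l ?(mulr_ge0 (ltW C00) (ltW l0))// -subr_ge0.
    by rewrite (_ : _ - _ = (l - c) ^+ 2) ?sqr_ge0//; ring.
  have -> : u0 * c ^+ 2 = l ^+ 3 * c ^+ 2 + K * l ^+ 2 * c ^+ 2 by rewrite mulrDl.
  have -> : C0 * l * (2 * l ^+ 2 + 2 * c ^+ 2) = l ^+ 3 * (2 * C0) + 2 * C0 * l * c ^+ 2 by ring.
  apply: lerD; first by rewrite ler_wpM2l// exprn_ge0// ltW.
  have ll : l <= l ^+ 2 by rewrite expr2 ler_peMl// ltW.
  by rewrite ler_wpM2r ?sqr_ge0// ler_pM ?mulr_ge0 ?(ltW C00) ?(ltW l0).
by rewrite natrD mulrDl in h1; lra.
Qed.

(** [u0] contributes [L] and the [K] term; (l + c) / c <= (1 + c) l contributes [M]; the 2 pays for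
    rounding in [N] and for the first term of the series, as l^2 / e^2 >= 1. *)
Lemma sample_complexity_bound :
  N%:R + (1 + ((e * (c / (l + c))) ^+ 2)^-1) <=
  L / e ^+ 2 + (K + M + 2) * (L `^ (2 / 3) / e ^+ 2).
Proof.
have l0 : 0 < l := lt_le_trans ltr01 l_ge1.
have c0 : 0 < c := lt_le_trans ltr01 c1.
have lc0 : 0 < l + c by have := c1; lra.
have lM : ((e * (c / (l + c))) ^+ 2)^-1 <= M * l ^+ 2 / e ^+ 2.
  have -> : ((e * (c / (l + c))) ^+ 2)^-1 = ((l + c) / c) ^+ 2 / e ^+ 2.
    by field; rewrite !gt_eqF.
  rewrite ler_pM2r ?invr_gt0// /M -exprMn.
  have c10 : 0 <= 1 + c by rewrite ltW// (lt_trans c0)// ltrDr.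
  rewrite lerXn2r ?nnegrE ?(divr_ge0 (ltW lc0) (ltW c0)) ?(mulr_ge0 c10 (ltW l0))//.
  rewrite ler_pdivrMr// (_ : (1 + c) * l * c = c * l + c * l * c); last by ring.
  have cl : 1 <= c * l by rewrite mulr_ege1.
  by rewrite lerD ?ler_peMl ?(ltW c0) ?(ltW l0).
have le1 : 1 <= l ^+ 2 / e ^+ 2.
  rewrite ler_pdivlMr// mul1r lerXn2r ?nnegrE ?(ltW e0) ?(ltW l0)//.
  by apply: le_trans l_ge1; case/andP: e01.
have u0E : u0 / e ^+ 2 = L / e ^+ 2 + K * (l ^+ 2 / e ^+ 2).
  by rewrite /u0 mulrDl l_cube mulrA.
rewrite -l_sqr; rewrite -mulrA in lM; have := N_le; rewrite u0E; lra.
Qed.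

(** Common to both stopping times, with [e] equal to [eps] or to the distance of the distributions.
    From [N] on, [Phi_le_margin] supplies [Phi <= e]. *)
Lemma expected_time_le {d : measure_display} {T : measurableType d}
    (P : probability T R) (G : nat -> set T) :
  (forall t, measurable (G t)) ->
  (forall t, (0 < t)%N -> Phi n delta t <= e ->
    (P (~` G t) <=
      (2 ^+ n * expR (- (t%:R * (e - Phi n delta t) ^+ 2)))%:E)%E) ->
  (\int[P]_w ereal_inf [set t%:R%:E | t in [set t : nat | (0 < t)%N /\ G t w]] <=
    (L / e ^+ 2 + (K + M + 2) * (L `^ (2 / 3) / e ^+ 2))%:E)%E.
Proof.
move=> mG PG; apply: (@le_trans _ _ (N%:R + (1 + ((e * (c / (l + c))) ^+ 2)^-1))%:E); last first.
  by rewrite lee_fin sample_complexity_bound.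
have l0 : 0 < l := lt_le_trans ltr01 l_ge1.
have c0 : 0 < c := lt_le_trans ltr01 c1.
have lc0 : 0 < l + c := addr_gt0 l0 c0.
apply: (stopping_time_integral_le mG (ltn0Sn _)
    (v := fun k => expR (- (k%:R * (e * (c / (l + c))) ^+ 2)))) => [k|m].
  apply: le_trans (PG _ _ _) _; rewrite ?addn_gt0//; last by rewrite lee_fin deviation_decay.
  apply: le_trans (Phi_le_margin (leq_addr _ _)) _.
  by rewrite ler_piMr ?(ltW e0)// ler_pdivrMr// mul1r lerDl ltW.
by apply: geometric_sum_expR_le; rewrite exprn_gt0// mulr_gt0// divr_gt0.
Qed.

End SampleComplexity.

Unset Implicit Arguments.

Theorem theorem3 (R : realType) :
  (forall (n : nat) (eps delta : R),
     (2 <= n)%N -> 0 < eps < 1 -> 0 < delta < 1 ->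
     delta_correct (@algorithm2 R n eps delta) eps delta) /\
  (forall C0 : R, 0 < C0 -> exists C : R, 0 < C /\
   forall (n : nat) (eps delta : R),
     (2 <= n)%N -> 0 < eps < 1 -> 0 < delta < 1 ->
     n%:R <= C0 * (ln delta^-1) `^ (3^-1) ->
   let L := ln (2 ^+ n.+1 / delta) in
   forall (d : measure_display) (T : measurableType d) (P : probability T R)
     (A B : nat -> T -> 'I_n),
     (forall D : 'I_n -> R,
        is_distribution D -> iid_samples P A B D D ->
        ln eps^-1 <= C0 * (ln delta^-1) `^ (2 / 3) ->
        (\int[P]_w tau1 eps delta A B w <=
          (L / eps ^+ 2 + C * (L `^ (2 / 3) / eps ^+ 2))%:E)%E) /\
     (forall D1 D2 : 'I_n -> R,
        is_distribution D1 -> is_distribution D2 -> iid_samples P A B D1 D2 ->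
        eps < TV D1 D2 ->
        ln (TV D1 D2)^-1 <= C0 * (ln delta^-1) `^ (2 / 3) ->
        (\int[P]_w tau2 delta A B w <=
          (L / TV D1 D2 ^+ 2 + C * (L `^ (2 / 3) / TV D1 D2 ^+ 2))%:E)%E)).
Proof.
split=> [n eps delta n2 _ delta01|C0 C00]; first exact: algorithm2_delta_correct.
(* The constant is left to unification: [expected_time_le] yields [K + M + 2], and its positivity is
   shown last. *)
eexists; split; last first.
  move=> n eps delta n2 /andP[eps0 eps1] delta01 n_small L d T P A B.
  split=> [D dD AB eps_large|D1 D2 dD1 dD2 AB epsTV TV_large].
  - have e01 : 0 < eps <= 1 by rewrite eps0 ltW.
    apply: (expected_time_le n2 delta01 C00 e01 n_small eps_large
      (G := fun t => [set w | tv_at R A B t w <= eps - Phi n delta t])).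
      by move=> t; exact: TV_le_measurable AB.
    move=> t t0 Phi_le; have -> : ~` [set w | tv_at R A B t w <= eps - Phi n delta t] =
        [set w | eps - Phi n delta t < tv_at R A B t w].
      by apply/seteqP; split => w /=; rewrite ltNge => /negP.
    by apply: (TV_deviation_null dD AB t0); rewrite subr_ge0.
  - have e01 : 0 < TV D1 D2 <= 1 by rewrite (lt_trans eps0 epsTV) TV_le1.
    apply: (expected_time_le n2 delta01 C00 e01 n_small TV_large
      (G := fun t => [set w | Phi n delta t < tv_at R A B t w])).
      by move=> t; exact: TV_ge_measurable AB.
    move=> t t0 Phi_le; have -> : ~` [set w | Phi n delta t < tv_at R A B t w] =
        [set w | tv_at R A B t w <= Phi n delta t].
      by apply/seteqP; split => w /=; rewrite leNgt => /negP.
    apply: le_trans (TV_deviation_low dD1 dD2 AB t0 Phi_le) _.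
    (* A factor 2^n >= 1 is inserted to reach the form shared with the null case. *)
    by rewrite lee_fin ler_peMl ?expR_ge0// exprn_ege1// ler1n.
have := sqr_ge0 (1 + (1 + 2 * C0)); set M := _ ^+ 2 => M0.
by have := sqr_ge0 M; have := mulr_ge0 (ltW C00) M0; lra.
Qed.
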